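(* Let $L$ be a finite distributive lattice and $K$ a field. The Hibi ring $K[L]$ can be realised as generated by a sortable set of monomials indexed by the elements of $L$: there exist a polynomial ring $S=K[t_1,\ldots,t_s]$, a positive integer $q$, and pairwise distinct monomials $m_I\in S$ of degree $q$, $I\in L$, such that $B=\{m_I\mid I\in L\}$ is a sortable set and $x_I\mapsto m_I$ induces a $K$-algebra isomorphism from $K[L]$ onto the subalgebra $K[B]\subseteq S$ generated by $B$. Moreover, the monomials satisfy $\operatorname{sort}(m_I,m_J)=(m_{I\wedge J},m_{I\vee J})$ for all $I,J\in L$.
   Context: The Hibi ring of a finite distributive lattice $L$ is $K[L]=K[x_I\mid I\in L]/(x_Ix_J-x_{I\wedge J}x_{I\vee J}\mid I,J\in L)$. Sorting: for two monomials $u_1,u_2$ of the same degree $q$ in $K[t_1,\ldots,t_s]$ (with the variables in the fixed order $t_1,\ldots,t_s$), write $u_1u_2=t_{i_1}t_{i_2}\cdots t_{i_{2q}}$ with $i_1\le i_2\le\cdots\le i_{2q}$; then $\operatorname{sort}(u_1,u_2)=(t_{i_1}t_{i_3}\cdots t_{i_{2q-1}},\,t_{i_2}t_{i_4}\cdots t_{i_{2q}})$. A set $B$ of monomials of the same degree is sortable if $\operatorname{sort}(B\times B)\subseteq B\times B$. *)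

(* Defs.v *)
From HB Require Import structures.
From mathcomp Require Import all_boot all_order all_algebra.
From mathcomp Require Import generic_quotient ring_quotient boolp.
From mathcomp Require Import mpoly.

Set Implicit Arguments.
Unset Strict Implicit.
Unset Printing Implicit Defensive.

Import Order.TTheory GRing.Theory.
Local Open Scope ring_scope.
Local Open Scope quotient_scope.

Section HibiRing.
Context (K : fieldType) (d : Order.disp_t) (L : finDistrLatticeType d).

(* The variables x_I, for I in L, are indexed through [enum_rank]. *)
Definition hibi_var (I : L) : {mpoly K[#|L|]} := 'X_(enum_rank I).

Definition hibi_rel (I J : L) : {mpoly K[#|L|]} :=
  hibi_var I * hibi_var J
  - hibi_var (Order.meet I J) * hibi_var (Order.join I J).

Definition hibi_ideal : {pred {mpoly K[#|L|]}} := fun f =>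
  `[< exists c : L -> L -> {mpoly K[#|L|]},
        f = \sum_I \sum_J c I J * hibi_rel I J >].

Lemma hibi_ideal_closed : idealr_closed hibi_ideal.
Proof.
split=> [||a u v].
- apply/asboolP; exists (fun _ _ => 0).
  by rewrite big1 // => I _; rewrite big1 // => J _; rewrite mul0r.
- apply/asboolP=> -[c /(congr1 (mmap idfun (fun=> 0)))].
  rewrite rmorph1 rmorph_sum big1 ?(rwP eqP) ?oner_eq0 // => I _.
  rewrite rmorph_sum big1 // => J _.
  rewrite rmorphM rmorphB /= !rmorphM /= !mmapX !mmap1U.
  by rewrite !mulr0 subrr mulr0.
- move=> /asboolP[c ->] /asboolP[e ->]; apply/asboolP.
  exists (fun I J => a * c I J + e I J).
  rewrite mulr_sumr -big_split; apply: eq_bigr => I _.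
  rewrite /= mulr_sumr -big_split; apply: eq_bigr => J _.
  by rewrite /= mulrDl mulrA.
Qed.

HB.instance Definition _ :=
  isIdealr.Build {mpoly K[#|L|]} hibi_ideal hibi_ideal_closed.

Definition hibi_ring : Type := {ideal_quot hibi_ideal}.

HB.instance Definition _ := GRing.ComNzRing.on hibi_ring.

Definition hibi_gen (I : L) : hibi_ring := \pi_({ideal_quot hibi_ideal}) (hibi_var I).

Definition hibi_scale (a : K) (x : hibi_ring) : hibi_ring :=
  (\pi_({ideal_quot hibi_ideal}) a%:MP : hibi_ring) * x.

Fact hibi_scaleA a b x : hibi_scale a (hibi_scale b x) = hibi_scale (a * b) x.
Proof. by rewrite /hibi_scale mulrA mpolyCM rmorphM. Qed.

Fact hibi_scale1 : left_id 1 hibi_scale.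
Proof. by move=> x; rewrite /hibi_scale mpolyC1 rmorph1 mul1r. Qed.

Fact hibi_scaleDr : right_distributive hibi_scale +%R.
Proof. by move=> a x y; rewrite /hibi_scale mulrDr. Qed.

Fact hibi_scaleDl x : {morph hibi_scale^~ x : a b / a + b}.
Proof. by move=> a b; rewrite /hibi_scale mpolyCD rmorphD mulrDl. Qed.

HB.instance Definition _ := GRing.Zmodule_isLmodule.Build K hibi_ring
  hibi_scaleA hibi_scale1 hibi_scaleDr hibi_scaleDl.

Fact hibi_scaleAl (a : K) (x y : hibi_ring) : a *: (x * y) = a *: x * y.
Proof. exact: mulrA. Qed.

HB.instance Definition _ :=
  GRing.Lmodule_isLalgebra.Build K hibi_ring hibi_scaleAl.

Fact hibi_scaleAr (a : K) (x y : hibi_ring) : a *: (x * y) = x * (a *: y).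
Proof. exact: mulrCA. Qed.

HB.instance Definition _ :=
  GRing.Lalgebra_isAlgebra.Build K hibi_ring hibi_scaleAr.

End HibiRing.

Section Sorting.
Context (s : nat).

(* The weakly increasing sequence of indices i_1 <= ... <= i_r such that
   u = t_{i_1} ... t_{i_r}. *)
Definition mnm_word (u : 'X_{1..s}) : seq 'I_s :=
  flatten [seq nseq (u i) i | i <- enum 'I_s].

Definition word_mnm (w : seq 'I_s) : 'X_{1..s} := (\sum_(i <- w) U_(i))%MM.

(* [iota] numbers positions from 0, so the factors of odd rank i_1, i_3, ...
   sit at the even positions. *)
Definition sort_mnm (u v : 'X_{1..s}) : 'X_{1..s} * 'X_{1..s} :=
  let w := mnm_word (u + v)%MM in
  (word_mnm (mask [seq ~~ odd k | k <- iota 0 (size w)] w),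
   word_mnm (mask [seq odd k | k <- iota 0 (size w)] w)).

Definition sortable (B : {pred 'X_{1..s}}) : Prop :=
  {in B &, forall u v, mdeg u = mdeg v} /\
  {in B &, forall u v, ((sort_mnm u v).1 \in B) && ((sort_mnm u v).2 \in B)}.

End Sorting.

Definition subalg_gen (K : fieldType) (A : algType K) (G : {pred A}) (f : A)
    : Prop :=
  forall S : {pred A}, GRing.subalg_closed S -> {subset G <= S} -> f \in S.

(* Main.v *)
From HB Require Import structures.
Require Import Defs.
From mathcomp Require Import all_boot all_order all_algebra.
From mathcomp Require Import generic_quotient ring_quotient boolp.
From mathcomp Require Import mpoly.

Set Implicit Arguments.
Unset Strict Implicit.
Unset Printing Implicit Defensive.

Import Order.TTheory GRing.Theory.
Local Open Scope ring_scope.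

(** Call a map chi : L -> bool a character when it turns meets into conjunctions
    and joins into disjunctions; it is the indicator of a prime filter, of the
    empty set or of L.  By distributivity the characters of L separate its
    elements ([exists_char]).  Number them p = 0, ..., n - 1, attach to p the two
    adjacent variables t_(2p) and t_(2p+1), and let m_I ([char_mnm]) be the
    product over p of t_(2p) or t_(2p+1) according to whether p is false or true
    at I.  The constant characters are among them, hence n > 0.

    Sorting.  In m_I m_J each p contributes two variables out of its own pair, and
    the pairs occupy consecutive blocks of the sorted word.  Within block p the
    smaller variable, which is that of p(I) && p(J) = p(I /\ J), comes first and
    the larger one, that of p(I) || p(J) = p(I \/ J), comes second.  Taking every
    other letter therefore returns m_(I /\ J) and m_(I \/ J) ([sort_char_mnm]).
    In particular m_I m_J = m_(I /\ J) m_(I \/ J), so x_I |-> m_I is defined on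
    the Hibi ring.

    Injectivity.  The Hibi relation lets one bubble-sort a product of generators:
    every monomial equals, in the Hibi ring, the monomial of a chain
    ([hibi_monomial_chain_sort]).  A character maps this chain to the sorted
    sequence of its own values ([chain_sort_char]), and the number of true and of
    false values is an exponent of the image monomial.  As characters separate
    points, two monomials of equal image have the same chain
    ([char_mnm_sum_determines]), hence the same class in the Hibi ring.  Grouping
    the terms of a polynomial by the image of their monomial then shows that the
    kernel of x_I |-> m_I is the Hibi ideal ([toric_map_eq0]). *)

(** * Monomials as sorted words *)

Section Words.
Context (s : nat).
Implicit Types (u v : 'X_{1..s}) (w : seq 'I_s).

Lemma word_mnmE w i : word_mnm w i = count_mem i w.
Proof.
rewrite /word_mnm mnm_sumE -sum1_count [RHS]big_mkcond /=.
by apply: eq_bigr => j _; rewrite mnm1E; case: eqP.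
Qed.

Lemma count_mnm_word u i : count_mem i (mnm_word u) = u i.
Proof.
rewrite /mnm_word count_flatten -map_comp sumnE big_map big_enum /=.
rewrite (bigD1 i) //= count_nseq /= eqxx mul1n big1 ?addn0 // => j ji.
by rewrite count_nseq /= (negbTE ji) mul0n.
Qed.

Lemma mnm_wordK : cancel (@mnm_word s) (@word_mnm s).
Proof. by move=> u; apply/mnmP => i; rewrite word_mnmE count_mnm_word. Qed.

Let le_ord : rel 'I_s := fun i j => (i <= j)%N.

Lemma mnm_word_sorted u : sorted le_ord (mnm_word u).
Proof.
have le_ord_trans : transitive le_ord by move=> j i k; apply: leq_trans.
rewrite /mnm_word sorted_pairwise //.
have : pairwise le_ord (enum 'I_s).
  rewrite -sorted_pairwise //.
  have := iota_sorted 0 s; rewrite -val_enum_ord.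
  by rewrite sorted_map.
elim: (enum 'I_s) => //= i t IH /andP[lit /IH{}IH].
rewrite pairwise_cat IH andbT; apply/andP; split.
  apply/allrelP => j k; rewrite mem_nseq => /andP[_ /eqP->].
  case/flattenP => _ /mapP[h ht ->]; rewrite mem_nseq => /andP[_ /eqP->].
  exact: (allP lit).
elim: (u i) => //= k ->; rewrite andbT.
by apply/allP => j; rewrite mem_nseq => /andP[_ /eqP->]; apply: leqnn.
Qed.

(** A word is determined by its letter counts once it is sorted, so any sorted
    word spelling a monomial is the one used to sort. *)
Lemma word_mnmK w : sorted le_ord w -> mnm_word (word_mnm w) = w.
Proof.
move=> ws; apply: (@sorted_eq _ le_ord) => //.
- by move=> j i k; apply: leq_trans.
- by move=> i j ij; apply/val_inj/anti_leq.
- exact: mnm_word_sorted.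
by apply/allP => i _ /=; rewrite count_mnm_word word_mnmE.
Qed.

Definition interleave (ps : seq ('I_s * 'I_s)) : seq 'I_s :=
  flatten [seq [:: p.1; p.2] | p <- ps].

(** The even starting position k makes the induction go through: each pair moves
    the positions by two. *)
Lemma mask_interleave (ps : seq ('I_s * 'I_s)) k : ~~ odd k ->
  let w := interleave ps in
  mask [seq ~~ odd j | j <- iota k (size w)] w = [seq p.1 | p <- ps] /\
  mask [seq odd j | j <- iota k (size w)] w = [seq p.2 | p <- ps].
Proof.
elim: ps k => [|p ps IH] k ek //=.
rewrite negbK ek (negbTE ek) /=.
by have [|-> ->] := IH k.+2; rewrite ?negbK.
Qed.

Lemma word_mnm_interleave (ps : seq ('I_s * 'I_s)) :
  word_mnm (interleave ps) =
  (word_mnm [seq p.1 | p <- ps] + word_mnm [seq p.2 | p <- ps])%MM.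
Proof.
apply/mnmP => i; rewrite mnmDE !word_mnmE.
by elim: ps => //= p ps ->; rewrite addnA addnACA addnA.
Qed.

(** To sort a product it suffices to exhibit its letters as a weakly increasing
    list of consecutive pairs. *)
Lemma sort_interleave (ps : seq ('I_s * 'I_s)) u v :
  sorted le_ord (interleave ps) ->
  (u + v = word_mnm (interleave ps))%MM ->
  sort_mnm u v = (word_mnm [seq p.1 | p <- ps], word_mnm [seq p.2 | p <- ps]).
Proof.
move=> ps_sorted uv; rewrite /sort_mnm uv word_mnmK //.
by have [-> ->] := mask_interleave ps (isT : ~~ odd 0).
Qed.

End Words.

(** * The monomials attached to characters of a lattice *)

Lemma double_bit_lt (k : nat) (b : bool) : (k.*2 + b < k.+1.*2)%N.
Proof. by rewrite doubleS ltnS -addn1 leq_add2l; case: b. Qed.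

Section CharacterMonomials.
Context (d : Order.disp_t) (L : finDistrLatticeType d) (n : nat).
Context (chi : 'I_n -> L -> bool).

Lemma char_var_subproof (p : 'I_n) (b : bool) : (p.*2 + b < n.*2)%N.
Proof. by apply: (leq_trans (double_bit_lt p b)); rewrite leq_double. Qed.

Definition char_var p b : 'I_n.*2 := Ordinal (char_var_subproof p b).

Lemma char_var_inj p q b c : (char_var p b == char_var q c) = (p == q) && (b == c).
Proof.
rewrite -!val_eqE /=; apply/eqP/andP => [E|[/eqP-> /eqP->]//].
have /eqP bc : b = c by have := congr1 odd E; rewrite !oddD !odd_double !oddb.
split=> //; move: E; rewrite (eqP bc) => /addIn E.
by rewrite -(doubleK p) E doubleK.
Qed.

(** The hypothesis orders the two letters inside block p; letters of different
    blocks are ordered by the block number. *)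
Lemma interleave_var_sorted (a b : 'I_n -> bool) : (forall p, a p ==> b p) ->
  sorted (fun i j : 'I_n.*2 => i <= j)%N
    (interleave [seq (char_var p (a p), char_var p (b p)) | p <- enum 'I_n]).
Proof.
move=> ab.
have : sorted (fun p q : 'I_n => p < q)%N (enum 'I_n).
  by have := iota_ltn_sorted 0 n; rewrite -val_enum_ord sorted_map.
case: (enum 'I_n) => //= p ps ps_lt.
have le_ab (q : 'I_n) : (q.*2 + a q <= q.*2 + b q)%N.
  by rewrite leq_add2l; have := ab q; by case: (a q) (b q) => [] [].
rewrite le_ab /=; elim: ps p ps_lt => //= q ps IH p /andP[pq /IH->].
rewrite le_ab !andbT /=; apply: (@leq_trans q.*2); last exact: leq_addr.
by apply: (leq_trans (ltnW (double_bit_lt p (b p)))); rewrite leq_double.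
Qed.

Definition char_mnm (I : L) : 'X_{1..n.*2} :=
  word_mnm [seq char_var p (chi p I) | p <- enum 'I_n].

(** The exponents of m_I are the values of the characters at I; this is how a
    product of monomials m_I remembers the multiset of values of each character. *)
Lemma char_mnmE I p b : char_mnm I (char_var p b) = (chi p I == b).
Proof.
rewrite word_mnmE count_map -sum1_count big_mkcond big_enum /=.
rewrite (bigD1 p) //= char_var_inj eqxx /= big1 ?addn0 => [|q qp].
  by case: eqP.
by rewrite char_var_inj (negbTE qp).
Qed.

Lemma mdeg_char_mnm I : mdeg (char_mnm I) = n.
Proof.
rewrite /char_mnm /word_mnm mdeg_sum big_map.
under eq_bigr do rewrite mdeg1.
by rewrite big_const_seq iter_addn_0 mul1n count_predT size_enum_ord.
Qed.

Hypothesis chi_meet : forall p I J, chi p (Order.meet I J) = chi p I && chi p J.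
Hypothesis chi_join : forall p I J, chi p (Order.join I J) = chi p I || chi p J.
Hypothesis chi_sep : forall I J, (forall p, chi p I = chi p J) -> I = J.

Lemma char_mnm_inj : injective char_mnm.
Proof.
move=> I J /mnmP IJ; apply: chi_sep => p.
have := IJ (char_var p true); rewrite !char_mnmE.
by case: (chi p I) (chi p J) => [] [].
Qed.

Lemma char_mnm_modular I J :
  (char_mnm I + char_mnm J =
   char_mnm (Order.meet I J) + char_mnm (Order.join I J))%MM.
Proof.
rewrite /char_mnm /word_mnm !big_map -!big_split /=.
apply: eq_bigr => p _; rewrite chi_meet chi_join.
case: (chi p I) (chi p J) => [] [] //=; exact: addmC.
Qed.

Lemma sort_char_mnm I J :
  sort_mnm (char_mnm I) (char_mnm J) =
  (char_mnm (Order.meet I J), char_mnm (Order.join I J)).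
Proof.
pose ps := [seq (char_var p (chi p (Order.meet I J)),
                 char_var p (chi p (Order.join I J))) | p <- enum 'I_n].
have ps1 : word_mnm [seq x.1 | x <- ps] = char_mnm (Order.meet I J).
  by rewrite /ps -map_comp.
have ps2 : word_mnm [seq x.2 | x <- ps] = char_mnm (Order.join I J).
  by rewrite /ps -map_comp.
rewrite -ps1 -ps2; apply: sort_interleave.
  apply: interleave_var_sorted => p; rewrite chi_meet chi_join.
  by apply/implyP => /andP[->].
by rewrite word_mnm_interleave ps1 ps2 char_mnm_modular.
Qed.

End CharacterMonomials.

(** * Characters separate the elements of a distributive lattice *)

Section Separation.
Context (d : Order.disp_t) (L : finDistrLatticeType d).

Definition is_char (f : {ffun L -> bool}) : bool :=
  [forall I, forall J, (f (Order.meet I J) == f I && f J)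
                    && (f (Order.join I J) == f I || f J)].

Lemma is_charP (f : {ffun L -> bool}) :
  reflect (forall I J, f (Order.meet I J) = f I && f J /\
                       f (Order.join I J) = f I || f J) (is_char f).
Proof.
apply: (iffP 'forall_forallP) => [H I J|H I J].
  by have /andP[/eqP-> /eqP->] := H I J.
by have [-> ->] := H I J; rewrite !eqxx.
Qed.

(** Take p minimal among the elements below I but not below J.  By minimality, if p
    is not below x then p /\ x is below J; by distributivity p is thus
    join-prime, and the filter above p is the required character. *)
Lemma exists_char (I J : L) : ~~ (I <= J)%O ->
  exists2 f, is_char f & f I && ~~ f J.
Proof.
pose below (p : L) := (p <= I)%O && ~~ (p <= J)%O.
move=> IJ; have bI : below I by rewrite /below lexx.
case: (@arg_minnP _ I below (fun p => #|[pred x | (x <= p)%O]|) bI) => p.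
move=> /andP[pI pJ] pmin.
have p_prime x : (p <= x)%O || (Order.meet p x <= J)%O.
  apply: contraT; rewrite negb_or => /andP[px pxJ].
  have := pmin (Order.meet p x); rewrite /below pxJ (le_trans (leIl _ _) pI).
  (* Minimality is measured by the size of the down-set, which shrinks strictly
     from p to p /\ x. *)
  move=> /(_ isT); rewrite leqNgt => /negP[].
  apply/proper_card/properP; split.
    by apply/subsetP => y; rewrite !inE lexI => /andP[].
  by exists p; rewrite !inE ?lexx // lexI lexx.
exists [ffun x => (p <= x)%O]; last by rewrite !ffunE pI.
apply/is_charP => x y; rewrite !ffunE lexI; split=> //.
apply/idP/orP => [pxy|[/le_trans->|/le_trans->]//]; last first.
- exact: leUr.
- exact: leUl.
case/orP: (p_prime x) => [|pxJ]; first by left.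
case/orP: (p_prime y) => [|pyJ]; first by right.
case/negP: pJ; rewrite -(meet_l pxy) meetUr leUx; exact/andP.
Qed.

End Separation.

(** * Straightening monomials in the Hibi ring *)

Section HibiPresentation.
Context (K : fieldType) (d : Order.disp_t) (L : finDistrLatticeType d).
Local Notation H := (hibi_ring K L).
Local Notation A := {mpoly K[#|L|]}.

(** The projection is retyped with codomain [hibi_ring], whose scalar action it
    respects. *)
Definition hibi_pi (f : A) : H := \pi_({ideal_quot (@hibi_ideal K d L)})%qT f.

Lemma hibi_pi_zmod : zmod_morphism hibi_pi.
Proof. exact: raddfB. Qed.

Lemma hibi_pi_monoid : monoid_morphism hibi_pi.
Proof. by split=> [|f g]; [exact: rmorph1 | exact: rmorphM]. Qed.

HB.instance Definition _ := GRing.isZmodMorphism.Build A H hibi_pi hibi_pi_zmod.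
HB.instance Definition _ :=
  GRing.isMonoidMorphism.Build A H hibi_pi hibi_pi_monoid.

Lemma hibi_pi_scalable : scalable hibi_pi.
Proof. by move=> a f; rewrite -mul_mpolyC rmorphM. Qed.

HB.instance Definition _ :=
  GRing.isScalable.Build K A H *:%R hibi_pi hibi_pi_scalable.

Lemma hibi_piP (x : H) : exists f, x = hibi_pi f.
Proof. by exists (repr x); rewrite /hibi_pi reprK. Qed.

Lemma hibi_pi_eq0 f : reflect
  (exists c : L -> L -> A, f = \sum_I \sum_J c I J * hibi_rel K I J)
  (hibi_pi f == 0).
Proof.
rewrite -(raddf0 hibi_pi) -Quotient.idealrBE subr0; exact: asboolP.
Qed.

Lemma hibi_gen_straighten I J :
  hibi_gen K I * hibi_gen K J =
  hibi_gen K (Order.meet I J) * hibi_gen K (Order.join I J) :> H.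
Proof.
apply/eqP; rewrite -subr_eq0.
have -> : hibi_gen K I * hibi_gen K J
  - hibi_gen K (Order.meet I J) * hibi_gen K (Order.join I J)
  = hibi_pi (hibi_rel K I J).
  by rewrite /hibi_rel rmorphB !rmorphM.
apply/hibi_pi_eq0.
exists (fun I' J' => ((I' == I) && (J' == J))%:R).
rewrite (bigD1 I) //= (bigD1 J) //= !eqxx mul1r !big1 ?addr0 //.
  move=> I' /negbTE->; rewrite big1 // => J' _; exact: mul0r.
by move=> J' /negbTE->; rewrite mul0r.
Qed.

Definition hibi_monomial (w : seq L) : H := \prod_(I <- w) hibi_gen K I.

(** One pass of bubble sort in which comparing and swapping is replaced by meet and
    join: the Hibi relation rewrites x_J x_I as x_(J /\ I) x_(J \/ I), and the join
    is carried on.  The recursion is structural because everything after the head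
    lies above J /\ I. *)
Fixpoint chain_insert (J : L) (w : seq L) : seq L :=
  if w is x :: t then Order.meet J x :: chain_insert (Order.join J x) t
  else [:: J].

Definition chain_sort (w : seq L) : seq L := foldr chain_insert [::] w.

Lemma chain_insert_path x J w :
  (x <= J)%O -> path <=%O x w -> path <=%O x (chain_insert J w).
Proof.
elim: w x J => [|I w IH] x J xJ /=; first by rewrite xJ.
case/andP=> xI Iw; rewrite lexI xJ xI /=.
apply: IH; first exact: le_trans (leIl _ _) (leUl _ _).
by apply: path_le Iw; [exact: le_trans | exact: leIr].
Qed.

Lemma chain_sort_sorted w : sorted <=%O (chain_sort w).
Proof.
elim: w => //= J w; case: (chain_sort w) => //= I t It.
apply: chain_insert_path; first exact: le_trans (leIl _ _) (leUl _ _).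
by apply: path_le It; [exact: le_trans | exact: leIr].
Qed.

Lemma hibi_monomial_chain_insert J w :
  hibi_monomial (chain_insert J w) = hibi_gen K J * hibi_monomial w.
Proof.
rewrite /hibi_monomial; elim: w J => [|I w IH] J /=.
  by rewrite big_seq1 big_nil mulr1.
by rewrite !big_cons IH !mulrA -hibi_gen_straighten.
Qed.

(** Straightening: every monomial is congruent to the monomial of a multichain. *)
Lemma hibi_monomial_chain_sort w :
  hibi_monomial (chain_sort w) = hibi_monomial w.
Proof.
elim: w => //= J w IH.
by rewrite hibi_monomial_chain_insert IH /hibi_monomial big_cons.
Qed.

Lemma hibi_pi_monomial w :
  hibi_pi 'X_[word_mnm w] = hibi_monomial [seq enum_val i | i <- w].
Proof.
rewrite /word_mnm -mprodXE rmorph_prod /hibi_monomial big_map.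
by apply: eq_bigr => i _; rewrite /hibi_gen /hibi_var enum_valK.
Qed.

Lemma hibi_piE f : hibi_pi f =
  \sum_(u <- msupp f) f@_u *: hibi_monomial [seq enum_val i | i <- mnm_word u].
Proof.
rewrite {1}(mpolyE f) linear_sum; apply: eq_bigr => u _ /=.
by rewrite linearZ /= -hibi_pi_monomial mnm_wordK.
Qed.

End HibiPresentation.

(** On truth values, meet-and-join bubble sort is ordinary sorting, and a character
    commutes with meets and joins; so it sees only the multiset of its values. *)
Lemma chain_sort_char (d : Order.disp_t) (L : finDistrLatticeType d)
    (f : L -> bool) :
  (forall I J, f (Order.meet I J) = f I && f J /\
               f (Order.join I J) = f I || f J) ->
  forall w, map f (chain_sort w) = sort <=%O (map f w).
Proof.
move=> fhom w.
have f_homo : {homo f : I J / (I <= J)%O}.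
  move=> I J /meet_l IJ; have [+ _] := fhom I J.
  by rewrite IJ; case: (f I) (f J) => [] [].
apply: (sorted_eq le_trans le_anti).
- exact: homo_sorted f_homo _ (chain_sort_sorted w).
- exact/sort_sorted/le_total.
rewrite perm_sym perm_sort perm_sym.
elim: w => //= J w; rewrite -(perm_cons (f J)); apply: perm_trans.
elim: (chain_sort w) J => //= I t IH J.
have [-> fU] := fhom J I; have := IH (Order.join J I).
rewrite fU -(perm_cons (f J && f I)) => /perm_trans; apply.
by case: (f J) (f I) => [] [] //; apply: (permEl (perm_catCA [:: _] [:: _] _)).
Qed.

(** * The toric map and its kernel *)

Section Realisation.
Context (K : fieldType) (d : Order.disp_t) (L : finDistrLatticeType d).
Context (s : nat) (m : L -> 'X_{1..s}).

Hypothesis m_modular : forall I J,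
  (m I + m J = m (Order.meet I J) + m (Order.join I J))%MM.
(* The standard monomial of a product can be read off from its image. *)
Hypothesis m_determines : forall w1 w2 : seq L,
  (\sum_(I <- w1) m I = \sum_(I <- w2) m I)%MM ->
  chain_sort w1 = chain_sort w2.

Definition toric_map : {mpoly K[#|L|]} -> {mpoly K[s]} :=
  mmap (@mpolyC s K) (fun i => 'X_[m (enum_val i)]).

HB.instance Definition _ := GRing.RMorphism.on toric_map.

Lemma toric_mapZ a f : toric_map (a *: f) = a *: toric_map f.
Proof. by rewrite /toric_map mmapZ mul_mpolyC. Qed.

Lemma toric_map_var I : toric_map (hibi_var K I) = 'X_[m I].
Proof. by rewrite /toric_map /hibi_var mmapX mmap1U enum_rankK. Qed.

Definition toric_exp (u : 'X_{1..#|L|}) : 'X_{1..s} :=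
  (\sum_(I <- [seq enum_val i | i <- mnm_word u]) m I)%MM.

Lemma toric_map_X u : toric_map 'X_[u] = 'X_[toric_exp u].
Proof.
rewrite -{1}(mnm_wordK u) /word_mnm /toric_exp -!mprodXE rmorph_prod big_map.
by apply: eq_bigr => i _; rewrite /= -{1}(enum_valK i) toric_map_var.
Qed.

Lemma toric_mapE f :
  toric_map f = \sum_(u <- msupp f) f@_u *: 'X_[toric_exp u].
Proof.
rewrite {1}(mpolyE f) raddf_sum; apply: eq_bigr => u _ /=.
by rewrite toric_mapZ toric_map_X.
Qed.

Lemma toric_map_hibi_rel I J : toric_map (hibi_rel K I J) = 0.
Proof.
by rewrite rmorphB !rmorphM /= !toric_map_var -!mpolyXD m_modular subrr.
Qed.

(** The Hibi ideal lies in the kernel by modularity.  Conversely, monomials with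
    the same image have the same class in the Hibi ring, so the class of f is a
    combination of such classes whose coefficients are those of the image of f. *)
Lemma toric_map_eq0 f : (toric_map f == 0) = (hibi_pi f == 0).
Proof.
apply/eqP/hibi_pi_eq0 => [f0|[c ->]]; last first.
  rewrite rmorph_sum big1 // => I _; rewrite rmorph_sum big1 // => J _.
  by rewrite rmorphM /= toric_map_hibi_rel mulr0.
apply/hibi_pi_eq0/eqP; rewrite hibi_piE.
pose c (u : 'X_{1..#|L|}) : hibi_ring K L :=
  hibi_monomial K [seq enum_val i | i <- mnm_word u].
have c_exp u v : toric_exp u = toric_exp v -> c u = c v.
  move=> uv; rewrite /c -hibi_monomial_chain_sort (m_determines uv).
  exact: hibi_monomial_chain_sort.
(* Terms of f are grouped by their image e, one of the finitely many in W; the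
   inner coefficient sum is the coefficient of e in the image of f. *)
pose W := undup (map toric_exp (msupp f)).
have -> : \sum_(u <- msupp f) f@_u *: c u =
          \sum_(e <- W) \sum_(u <- msupp f | toric_exp u == e) f@_u *: c u.
  rewrite (exchange_big_dep xpredT) //= big_seq [RHS]big_seq.
  apply: eq_bigr => u uf; rewrite -big_filter.
  rewrite (eq_filter (a2 := pred1 (toric_exp u))); last first.
    by move=> e; rewrite /= eq_sym.
  by rewrite filter_pred1_uniq ?undup_uniq ?mem_undup ?map_f // big_seq1.
rewrite big_seq big1 // => e; rewrite mem_undup => /mapP[u0 _ ->{e}].
transitivity ((toric_map f)@_(toric_exp u0) *: c u0); last first.
  by rewrite f0 mcoeff0 scale0r.
rewrite toric_mapE raddf_sum scaler_suml big_mkcond; apply: eq_bigr => u _ /=.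
rewrite mcoeffZ mcoeffX; case: eqP => [/c_exp->|_]; first by rewrite mulr1.
by rewrite mulr0 scale0r.
Qed.

(** The map is evaluated on an arbitrary representative; independence of the choice
    is the inclusion of the Hibi ideal in the kernel. *)
Lemma toric_map_factor :
  exists phi : {lrmorphism hibi_ring K L -> {mpoly K[s]}},
    forall f, phi (hibi_pi f) = toric_map f.
Proof.
pose phi (x : hibi_ring K L) : {mpoly K[s]} := toric_map (repr x).
have phi_pi f : phi (hibi_pi f) = toric_map f.
  apply/eqP; rewrite -subr_eq0 -rmorphB toric_map_eq0 rmorphB subr_eq0.
  by rewrite /= /hibi_pi reprK.
have phiB : zmod_morphism phi.
  move=> x y; have [[f ->] [g ->]] := (hibi_piP x, hibi_piP y).
  by rewrite -rmorphB !phi_pi rmorphB.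
have phiM : monoid_morphism phi.
  split=> [|x y]; first by rewrite -(rmorph1 (@hibi_pi K d L)) phi_pi rmorph1.
  have [[f ->] [g ->]] := (hibi_piP x, hibi_piP y).
  by rewrite -rmorphM !phi_pi rmorphM.
have phiZ : scalable phi.
  move=> a x; have [f ->] := hibi_piP x.
  by rewrite -linearZ !phi_pi toric_mapZ.
pose phi_B := GRing.isZmodMorphism.Build _ _ phi phiB.
pose phi_M := GRing.isMonoidMorphism.Build _ _ phi phiM.
pose phi_Z := GRing.isScalable.Build K _ _ *:%R phi phiZ.
pose Phi : {lrmorphism hibi_ring K L -> {mpoly K[s]}} :=
  HB.pack phi phi_B phi_M phi_Z.
by exists Phi.
Qed.

(** The image is a subalgebra containing the generators; conversely each of its
    elements is a linear combination of products of generators. *)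
Lemma subalg_gen_toric_map (g : {mpoly K[s]}) :
  subalg_gen (mem [seq 'X_[K, u] | u <- codom m]) g <->
  exists f, toric_map f = g.
Proof.
split=> [g_gen|[f <-] S [S1 Slin SM] genS].
  apply/asboolP; apply: (g_gen (fun h => `[< exists f, toric_map f = h >])).
    split=> [|a u v|u v].
    - by apply/asboolP; exists 1; rewrite rmorph1.
    - move=> /asboolP[f <-] /asboolP[h <-]; apply/asboolP.
      by exists (a *: f + h); rewrite rmorphD /= toric_mapZ.
    - move=> /asboolP[f <-] /asboolP[h <-]; apply/asboolP.
      by exists (f * h); rewrite rmorphM.
  move=> _ /mapP[_ /codomP[I ->] ->]; apply/asboolP.
  by exists (hibi_var K I); rewrite toric_map_var.
have S0 : 0 \in S by rewrite -(addNr 1) -scaleN1r; apply: Slin.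
rewrite toric_mapE; apply: (big_ind (fun x => x \in S)) => // [u v uS vS|u _].
  by rewrite -[u]scale1r; apply: Slin.
rewrite -[X in X \in S]addr0; apply: Slin => //.
rewrite /toric_exp -mprodXE; apply: (big_ind (fun x => x \in S)) => // I _.
by apply/genS/map_f/codom_f.
Qed.

End Realisation.

(** * The realisation by character monomials *)

(** The straightened chains agree after applying any character, since their images
    are sorted lists of truth values with counts given by exponents; separation
    then gives equality entry by entry.  At least one character is required to
    recover the length of the chain. *)
Lemma char_mnm_sum_determines (d : Order.disp_t) (L : finDistrLatticeType d)
    (n : nat) (chi : 'I_n -> L -> bool)
    (chi_meet : forall p I J, chi p (Order.meet I J) = chi p I && chi p J)
    (chi_join : forall p I J, chi p (Order.join I J) = chi p I || chi p J)
    (chi_sep : forall I J, (forall p, chi p I = chi p J) -> I = J)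
    (n_gt0 : (0 < n)%N) (w1 w2 : seq L) :
  (\sum_(I <- w1) char_mnm chi I = \sum_(I <- w2) char_mnm chi I)%MM ->
  chain_sort w1 = chain_sort w2.
Proof.
move=> E.
have count_chi w p b :
    (\sum_(I <- w) char_mnm chi I)%MM (char_var p b) =
    count_mem b (map (chi p) w).
  rewrite mnm_sumE count_map -sum1_count [RHS]big_mkcond /=.
  by apply: eq_bigr => I _; rewrite char_mnmE; case: eqP.
have chi_chain p : map (chi p) (chain_sort w1) = map (chi p) (chain_sort w2).
  rewrite !chain_sort_char //; apply/perm_sortP => //.
  - exact: le_total.
  - exact: le_trans.
  - exact: le_anti.
  by apply/allP => b _ /=; rewrite -!count_chi E.
have size_chain : size (chain_sort w1) = size (chain_sort w2).
  by have := congr1 size (chi_chain (Ordinal n_gt0)); rewrite !size_map.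
case: w1 {E} chi_chain size_chain => [|I0 w1].
  by move=> _ /= /esym/size0nil.
move=> chi_chain size_chain; apply: (eq_from_nth (x0 := I0)) => // i lt_i.
apply: chi_sep => p.
by rewrite -!(nth_map I0 (chi p I0)) ?chi_chain // -size_chain.
Qed.

Theorem theorem4p1 (d : Order.disp_t) (L : finDistrLatticeType d)
    (K : fieldType) :
  exists (s q : nat) (m : L -> 'X_{1..s}),
    [/\ (0 < q)%N,
        forall I : L, mdeg (m I) = q,
        injective m,
        sortable (mem (codom m)) &
        exists phi : {lrmorphism hibi_ring K L -> {mpoly K[s]}},
          [/\ forall I : L, phi (hibi_gen K I) = 'X_[m I],
              injective phi &
              forall f : {mpoly K[s]},
                subalg_gen (mem [seq 'X_[K, u] | u <- codom m]) f <->
                exists h : hibi_ring K L, phi h = f]]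
    /\ (forall I J : L,
          sort_mnm (m I) (m J) = (m (Order.meet I J), m (Order.join I J))).
Proof.
pose chars := [pred f : {ffun L -> bool} | is_char f].
pose n := #|chars|.
pose chi (p : 'I_n) : L -> bool := (enum_val p : {ffun L -> bool}).
have chiP p I J : chi p (Order.meet I J) = chi p I && chi p J /\
                  chi p (Order.join I J) = chi p I || chi p J.
  by have /is_charP := enum_valP p; apply.
have chi_meet p I J := proj1 (chiP p I J).
have chi_join p I J := proj2 (chiP p I J).
have chi_le I J : (forall p, chi p I = chi p J) -> (I <= J)%O.
  move=> IJ; apply: contraT => /exists_char[f f_char /andP[fI fJ]].
  have := IJ (enum_rank_in (f_char : f \in chars) f).
  by rewrite /chi enum_rankK_in // fI (negbTE fJ).
have chi_sep I J : (forall p, chi p I = chi p J) -> I = J.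
  by move=> IJ; apply: le_anti; rewrite !chi_le.
have n_gt0 : (0 < n)%N.
  (* The constant character exists even when L has at most one element. *)
  apply/card_gt0P; exists [ffun=> true]; apply/is_charP => I J.
  by rewrite !ffunE.
have m_modular := char_mnm_modular chi_meet chi_join.
have m_sort := sort_char_mnm chi_meet chi_join.
have m_det := char_mnm_sum_determines chi_meet chi_join chi_sep n_gt0.
exists n.*2, n, (char_mnm chi); split=> //; split=> //.
- exact: mdeg_char_mnm.
- exact: char_mnm_inj.
- split=> u v /codomP[I ->] /codomP[J ->]; first by rewrite !mdeg_char_mnm.
  by rewrite m_sort !codom_f.
have [phi phi_pi] := toric_map_factor K m_modular m_det.
exists phi; split.
- by move=> I; rewrite -[hibi_gen K I]/(hibi_pi _) phi_pi toric_map_var.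
- apply: raddf_inj => x; have [f ->] := hibi_piP x.
  by rewrite /= phi_pi => /eqP; rewrite (toric_map_eq0 m_modular m_det) => /eqP.
move=> g; split=> [/subalg_gen_toric_map[f <-]|[x <-]].
  by exists (hibi_pi f).
by have [f ->] := hibi_piP x; apply/subalg_gen_toric_map; exists f.
Qed.
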